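(* Let $n\ge 2$, let $\underline Y=(Y_1,\dots,Y_n)$ be $n$ indeterminates over $\mathbb{F}_q$, and for $1\le i\le n$ put $d_i:=(-1)^{i-1}\Delta_{n-1}(\underline{\hat Y_i})$. For $k\ge 1$ put $$\alpha_k:=\sum_{i=1}^n d_i^{\,q^{k+1}}Y_i=\sum_{i=1}^n(-1)^{i-1}\Delta_{n-1}(\underline{\hat Y_i})^{q^{k+1}}Y_i .$$ Then $$\mathcal{M}_n(d_1,\dots,d_n)\;{}^t\mathcal{M}_n(\underline Y)=\begin{pmatrix} 0&\cdot&\cdot&\cdots&\cdot&0&(-1)^{n-1}\Delta_n(\underline Y)\\ \Delta_n(\underline Y)&0&\cdot&\cdots&\cdot&0&0\\ \alpha_1&\Delta_n(\underline Y)^q&0&\cdots&\cdot&0&0\\ \alpha_2&\alpha_1^q&\Delta_n(\underline Y)^{q^2}&\cdots&\cdot&0&0\\ \vdots&\vdots&\vdots&\cdots&\cdot&\vdots&\vdots\\ \alpha_{n-2}&\alpha_{n-3}^q&\cdot&\cdots&\alpha_1^{q^{n-3}}&\Delta_n(\underline Y)^{q^{n-2}}&0 \end{pmatrix}.$$ That is, writing $[m_{i,j}]_{1\le i,j\le n}$ for the product matrix: $m_{1,j}=0$ for $1\le j\le n-1$, $m_{1,n}=(-1)^{n-1}\Delta_n(\underline Y)$, and for $2\le i\le n$: $m_{i,j}=\alpha_{i-j-1}^{q^{j-1}}$ for $1\le j\le i-2$, $m_{i,i-1}=\Delta_n(\underline Y)^{q^{i-2}}$, and $m_{i,j}=0$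 for $i\le j\le n$.
   Context: $q=p^s$ is a power of a prime $p$. For a commutative ring $A$ containing $\mathbb{F}_q$ and $\underline a=(a_1,\dots,a_n)\in A^n$ with $n\ge 1$, the Moore matrix is $\mathcal{M}_n(\underline a):=\big(a_j^{q^{i-1}}\big)_{1\le i,j\le n}$ (row $i$, column $j$) and the Moore determinant is $\Delta_n(\underline a):=\det\mathcal{M}_n(\underline a)$. For $1\le i\le n$, $\underline{\hat Y_i}:=(Y_1,\dots,Y_{i-1},Y_{i+1},\dots,Y_n)$. ${}^tM$ denotes the transpose of $M$. *)

(* Defs.v *)
From HB Require Import structures.
From mathcomp Require Import all_boot all_order all_algebra.
From mathcomp Require Import mpoly.
Set Implicit Arguments.
Unset Strict Implicit.
Unset Printing Implicit Defensive.
Import GRing.Theory.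
Local Open Scope ring_scope.

(* All indices are 0-based: row i holds the q^i-th powers. *)
Definition moore (q : nat) (A : comNzRingType) (n : nat) (a : 'I_n -> A) :
    'M[A]_n :=
  \matrix_(i < n, j < n) a j ^+ (q ^ i)%N.

Definition moore_det (q : nat) (A : comNzRingType) (n : nat) (a : 'I_n -> A) :
    A :=
  \det (moore q a).

Definition omit (A : Type) (n : nat) (a : 'I_n -> A) (i : 'I_n) :
    'I_n.-1 -> A :=
  fun j => a (lift i j).

(* The sign (-1)^(i-1) of the 1-based convention becomes (-1)^i. *)
Definition moore_d (q : nat) (A : comNzRingType) (n : nat) (a : 'I_n -> A)
    (i : 'I_n) : A :=
  (-1) ^+ i * moore_det q (omit a i).

Definition moore_alpha (q : nat) (A : comNzRingType) (n : nat) (a : 'I_n -> A)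
    (k : nat) : A :=
  \sum_(i < n) moore_d q a i ^+ (q ^ k.+1)%N * a i.

Definition indets (F : finFieldType) (n : nat) : 'I_n -> {mpoly F[n]} :=
  fun i => 'X_i.

(* Main.v *)
(** Write M for the Moore matrix of Y. Up to sign, the d_k are the cofactors of
    the last row of M, while the d_k ^ q are the cofactors of its first row
    because x |-> x ^ q is a ring morphism. The adjugate identity
    M * adj M = Delta thus evaluates the sums of d_k * Y_k ^ (q ^ m) for m < n,
    and the sum of d_k ^ q * Y_k. Every entry of the product matrix is a
    q-power of such a sum or of some alpha_k. *)
Require Import Defs.
From HB Require Import structures.
From mathcomp Require Import all_boot all_order all_algebra.
From mathcomp Require Import finfield.
From mathcomp Require Import mpoly.
Import GRing.Theory.
Local Open Scope ring_scope.

(** The proof [pm] is an argument so that the m-th power map, an iterated Frobenius, can carry a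
    ring morphism instance; the generic morphism lemmas then apply to sums, determinants and
    signs. *)
Definition pchar_expr (A : comNzRingType) (m : nat)
  (pm : [pchar A].-nat m) (x : A) : A := x ^+ m.

Section PcharExpr.
Variables (A : comNzRingType) (m : nat) (pm : [pchar A].-nat m).

Fact pchar_expr_zmod_morphism : zmod_morphism (pchar_expr A m pm).
Proof. by move=> x y; rewrite /pchar_expr exprDn_pchar // exprNn_pchar. Qed.

Fact pchar_expr_monoid_morphism : monoid_morphism (pchar_expr A m pm).
Proof. by split=> [|x y]; rewrite /pchar_expr ?expr1n ?exprMn. Qed.

HB.instance Definition _ :=
  GRing.isZmodMorphism.Build A A (pchar_expr A m pm) pchar_expr_zmod_morphism.
HB.instance Definition _ :=
  GRing.isMonoidMorphism.Build A A (pchar_expr A m pm)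
    pchar_expr_monoid_morphism.

Lemma sum_expr_pchar (I : finType) (f : I -> A) :
  (\sum_i f i) ^+ m = \sum_i f i ^+ m.
Proof. exact: (rmorph_sum (pchar_expr A m pm)). Qed.

Lemma det_expr_pchar (n : nat) (M : 'M[A]_n) :
  \det M ^+ m = \det (\matrix_(i, j) M i j ^+ m).
Proof.
rewrite -[LHS]/(pchar_expr A m pm (\det M)) -det_map_mx.
by congr (\det _); apply/matrixP => i j; rewrite !mxE.
Qed.

(** A ring morphism fixes signs, so no case split on the parity of [m] is needed. *)
Lemma signr_expr_pchar (k : nat) : ((-1) ^+ k) ^+ m = (-1) ^+ k :> A.
Proof. exact: (rmorph_sign (pchar_expr A m pm)). Qed.

End PcharExpr.

Section MooreMatrix.
Variables (A : comNzRingType) (q : nat).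

(** Deleting the last row keeps the exponents q^0, ..., q^(n-1), so the minor is again a Moore
    determinant. *)
Lemma moore_cofactor_last (n : nat) (a : 'I_n.+1 -> A) (k : 'I_n.+1) :
  cofactor (moore q a) ord_max k = (-1) ^+ n * moore_d q a k.
Proof.
rewrite /cofactor /moore_d exprD -mulrA; congr (_ * (_ * \det _)).
by apply/matrixP => i j; rewrite !mxE /omit lift_max.
Qed.

Lemma sum_moore_d_expr (n : nat) (a : 'I_n.+1 -> A) (m : 'I_n.+1) :
  \sum_(k < n.+1) moore_d q a k * a k ^+ (q ^ m)%N =
  if m == n :> nat then (-1) ^+ n * moore_det q a else 0.
Proof.
(* The last column of the adjugate holds the last-row cofactors; the factor (-1)^n cancels their
   extra sign. *)
have := congr1 (fun M : 'M_n.+1 => (-1) ^+ n * M m ord_max)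
               (mul_mx_adj (moore q a)).
rewrite !mxE -/(moore_det q a) -val_eqE /= mulr_sumr => E.
transitivity ((-1) ^+ n * (moore_det q a *+ (m == n :> nat))).
  rewrite -E; apply: eq_bigr => k _.
  by rewrite !mxE moore_cofactor_last [in RHS]mulrCA signrMK mulrC.
by case: eqP; rewrite ?mulr0.
Qed.

Hypothesis pq : [pchar A].-nat q.

(** Deleting the first row leaves the exponents q, ..., q^n: each entry of the minor is the q-th
    power of an entry of a smaller Moore matrix. *)
Lemma moore_cofactor_first (n : nat) (a : 'I_n.+1 -> A) (k : 'I_n.+1) :
  cofactor (moore q a) ord0 k = moore_d q a k ^+ q.
Proof.
rewrite /cofactor /moore_d exprMn signr_expr_pchar // add0n; congr (_ * _).
rewrite det_expr_pchar //; congr (\det _); apply/matrixP => i j.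
by rewrite !mxE /omit -exprM -expnSr.
Qed.

Lemma sum_expr_moore_d (n : nat) (a : 'I_n.+1 -> A) :
  \sum_(k < n.+1) moore_d q a k ^+ q * a k = moore_det q a.
Proof.
rewrite /moore_det (expand_det_row _ ord0); apply: eq_bigr => k _.
by rewrite moore_cofactor_first mxE expr1 mulrC.
Qed.

Lemma pchar_nat_expn (k : nat) : [pchar A].-nat (q ^ k)%N.
Proof. by rewrite pnatX pq. Qed.

Lemma moore_alphaE (n : nat) (a : 'I_n -> A) (k : nat) :
  moore_alpha q a k =
  \sum_(i < n) (-1) ^+ i * moore_det q (omit a i) ^+ (q ^ k.+1)%N * a i.
Proof.
apply: eq_bigr => i _.
by rewrite /moore_d exprMn signr_expr_pchar // pchar_nat_expn.
Qed.

Lemma mul_moore_d_moore_tr (n : nat) (a : 'I_n -> A) :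
  moore q (moore_d q a) *m (moore q a)^T =
  \matrix_(i < n, j < n)
    (if i == 0%N :> nat then
       if j == n.-1 :> nat then (-1) ^+ n.-1 * moore_det q a else 0
     else if (j.+2 <= i)%N then moore_alpha q a (i - j - 1)%N ^+ (q ^ j)%N
     else if j.+1 == i :> nat then moore_det q a ^+ (q ^ j)%N
     else 0).
Proof.
case: n a => [|n] a; first by apply/matrixP => -[].
apply/matrixP => i j; rewrite !mxE.
under eq_bigr do rewrite !mxE.
have [le_ij|lt_ji] := leqP i j.
  have lt_ji_n : (j - i < n.+1)%N := leq_ltn_trans (leq_subr i j) (ltn_ord j).
  (* On or above the diagonal the common power q^i factors out, leaving the exponent q^(j-i) on
     [a k]. *)
  transitivity
      ((\sum_k moore_d q a k * a k ^+ (q ^ Ordinal lt_ji_n)%N) ^+ (q ^ i)%N).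
    rewrite sum_expr_pchar ?pchar_nat_expn //; apply: eq_bigr => k _ /=.
    by rewrite [RHS]exprMn -exprM -expnD subnK.
  rewrite sum_moore_d_expr /=.
  have [i0|i_gt0] := posnP i; first by rewrite i0 subn0 expr1.
  (* For i > 0, j - i < n makes the inner sum vanish; its power is 0 only because q^i is nonzero, as
     0^0 = 1. *)
  have q_gt0 : (0 < q)%N by case/andP: pq.
  rewrite ltn_eqF; last first.
    by rewrite -ltnS (leq_trans _ (ltn_ord j)) // ltnS ltn_subrL i_gt0
               (leq_trans i_gt0 le_ij).
  rewrite expr0n expn_eq0 (gtn_eqF q_gt0) /=.
  by rewrite ltnNge (leqW le_ij) /= gtn_eqF // ltnS.
(* Below the diagonal it is q^j that factors out, leaving the exponent q^(i-j) on the [moore_d]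
   factor: an alpha if i - j > 1, the first-row expansion if i - j = 1. *)
have -> : \sum_k moore_d q a k ^+ (q ^ i)%N * a k ^+ (q ^ j)%N =
    (\sum_k moore_d q a k ^+ (q ^ (i - j))%N * a k) ^+ (q ^ j)%N.
  rewrite sum_expr_pchar ?pchar_nat_expn //; apply: eq_bigr => k _.
  by rewrite [RHS]exprMn -exprM -expnD subnK // ltnW.
rewrite (gtn_eqF (leq_ltn_trans (leq0n j) lt_ji)).
have [lt_j1i|le_ij1] := ltnP j.+1 i.
  by rewrite /moore_alpha subn1 prednK // subn_gt0.
have -> : i = j.+1 :> nat by apply/eqP; rewrite eqn_leq le_ij1.
by rewrite subSnn expn1 eqxx sum_expr_moore_d.
Qed.

End MooreMatrix.

Theorem theorem4p2 (p s q : nat) (hp : prime p) (hs : (0 < s)%N)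
    (hq : q = (p ^ s)%N) (F : finFieldType) (hF : #|F| = q)
    (n : nat) (hn : (2 <= n)%N) :
  let Y := @indets F n in
  let Delta := moore_det q Y in
  let alpha := moore_alpha q Y in
  (forall k : nat, (1 <= k)%N ->
     alpha k =
     \sum_(i < n) (-1) ^+ i * moore_det q (omit Y i) ^+ (q ^ k.+1)%N * Y i) /\
  moore q (moore_d q Y) *m (moore q Y)^T =
  \matrix_(i < n, j < n)
    (if i == 0%N :> nat then
       if j == n.-1 :> nat then (-1) ^+ n.-1 * Delta else 0
     else if (j.+2 <= i)%N then alpha (i - j - 1)%N ^+ (q ^ j)%N
     else if j.+1 == i :> nat then Delta ^+ (q ^ j)%N
     else 0).
Proof.
move=> Y Delta alpha.
have pF : p \in [pchar F] by apply: (@card_finPcharP F p s); rewrite // hF.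
(* The characteristic passes to the polynomial ring along the constants. *)
have pY : p \in [pchar {mpoly F[n]}] by apply: (rmorph_pchar (@mpolyC n F)).
have pq : [pchar {mpoly F[n]}].-nat q by rewrite hq pnatX pnatE // pY.
by split=> [k _|]; [apply: moore_alphaE | apply: mul_moore_d_moore_tr].
Qed.
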